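(* Let $\{\mathbb{X}_n\}_{n\in\mathbb{N}}$ be a sequence of non-trivial normed linear spaces over $\mathbb{K}$. Let $p\in[1,\infty)\cup\{0\}$. If $p\in[1,\infty)$, let $q\in(1,\infty]$ be such that $\frac1p+\frac1q=1$; if $p=0$, set $q=1$. Then the dual of $\bigoplus_p\mathbb{X}_n$ is isometrically isomorphic to $\bigoplus_q\mathbb{X}_n^*$, where $f=\{f_n\}_{n\in\mathbb{N}}\in\bigoplus_q\mathbb{X}_n^*$ acts on $\bigoplus_p\mathbb{X}_n$ by $$f(x):=\sum_{n=1}^\infty f_n(x_n),\qquad x=\{x_n\}_{n\in\mathbb{N}}\in\bigoplus_p\mathbb{X}_n.$$
   Context: $\mathbb{K}=\mathbb{R}$ or $\mathbb{C}$; $\mathbb{X}^*$ is the continuous dual of a normed space $\mathbb{X}$; non-trivial means of dimension more than $0$. For a sequence of normed spaces $\mathbb{X}_n$: for $1\le p<\infty$, $\bigoplus_p\mathbb{X}_n$ is the space of sequences $\{x_n\}$ with $x_n\in\mathbb{X}_n$ and $\sum_n\|x_n\|^p<\infty$, with norm $\|\{x_n\}\|_p=(\sum_n\|x_n\|^p)^{1/p}$; $\bigoplus_\infty\mathbb{X}_n$ is the space of sequences with $\sup_n\|x_n\|<\infty$, with norm $\|\{x_n\}\|_\infty=\sup_n\|x_n\|$; $\bigoplus_0\mathbb{X}_n$ is the space of sequences with $\lim_n\|x_n\|=0$, with norm $\|\{x_n\}\|_0=\max_n\|x_n\|$. Operations are coordinatewise. *)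

(* Defs.v *)
From Stdlib Require Import Reals Lra Lia.
From Stdlib Require Import FunctionalExtensionality ProofIrrelevance.
From Coquelicot Require Import Coquelicot.
Open Scope R_scope.

Inductive scalar_field := Real_field | Complex_field.

Definition scalars (k : scalar_field) : AbsRing :=
  match k with Real_field => R_AbsRing | Complex_field => C_AbsRing end.

Coercion scalars : scalar_field >-> AbsRing.

Lemma scalars_mult_comm (k : scalar_field) (x y : k) : mult x y = mult y x.
Proof. destruct k; [apply Rmult_comm | apply Cmult_comm]. Qed.

Lemma scalars_real_mult (k : scalar_field) (t : R) :
  0 < t -> exists c d : k, mult c d = one /\ abs c = t /\ abs d = / t.
Proof.
intros Ht; destruct k.
- exists t, (/ t); repeat split.
  + unfold mult, one; simpl; field; lra.
  + apply Rabs_pos_eq; lra.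
  + apply Rabs_pos_eq, Rlt_le, Rinv_0_lt_compat, Ht.
- exists (RtoC t), (RtoC (/ t)); repeat split.
  + change (RtoC t * RtoC (/ t) = RtoC 1)%C.
    rewrite <- RtoC_mult; f_equal; field; lra.
  + change (Cmod (RtoC t) = t); rewrite Cmod_R; apply Rabs_pos_eq; lra.
  + change (Cmod (RtoC (/ t)) = / t); rewrite Cmod_R.
    apply Rabs_pos_eq, Rlt_le, Rinv_0_lt_compat, Ht.
Qed.

(* The normed module attached to a norm N on a module, with the uniform
   structure given by the balls of N. *)
Section NormedModuleOfNorm.

Context (K : AbsRing) (V : ModuleSpace K) (N : V -> R).
Context (N_plus : forall x y : V, N (plus x y) <= N x + N y).
Context (N_scal : forall (l : K) (x : V), N (scal l x) <= abs l * N x).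
Context (N_eq0 : forall x : V, N x = 0 -> x = zero).

Lemma N_opp (x : V) : N (opp x) <= N x.
Proof.
rewrite <- scal_opp_one.
eapply Rle_trans; [apply N_scal|]; rewrite abs_opp_one; lra.
Qed.

Lemma N_zero : N zero = 0.
Proof.
set (z := zero : V).
assert (Hs : scal (zero : K) z = z) by exact (scal_zero_l z).
assert (Hp : plus z (opp z) = z) by exact (plus_opp_r z).
pose proof (N_scal zero z) as H1; rewrite Hs, abs_zero in H1.
pose proof (N_plus z (opp z)) as H2; rewrite Hp in H2.
pose proof (N_opp z); lra.
Qed.

Lemma N_minus (x y : V) : N (minus x y) <= N (minus y x).
Proof.
rewrite <- (opp_minus y x); apply N_opp.
Qed.

Definition N_ball (x : V) (e : R) (y : V) := N (minus y x) < e.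

Lemma N_ball_center (x : V) (e : posreal) : N_ball x e x.
Proof.
unfold N_ball.
rewrite (eq_trans (f_equal N (minus_eq_zero x)) N_zero); apply cond_pos.
Qed.

Lemma N_ball_sym (x y : V) (e : R) : N_ball x e y -> N_ball y e x.
Proof. intros H; eapply Rle_lt_trans; [apply N_minus | exact H]. Qed.

Lemma N_ball_triangle (x y z : V) (e1 e2 : R) :
  N_ball x e1 y -> N_ball y e2 z -> N_ball x (e1 + e2) z.
Proof.
unfold N_ball; intros H1 H2.
rewrite (minus_trans y z x).
eapply Rle_lt_trans; [apply N_plus|]; lra.
Qed.

Definition norm_UniformSpace_mixin : UniformSpace.mixin_of V :=
  UniformSpace.Mixin V zero N_ball N_ball_center N_ball_sym N_ball_triangle.

Definition norm_NormedModuleAux : NormedModuleAux K :=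
  NormedModuleAux.Pack K V
    (NormedModuleAux.Class K V (ModuleSpace.class K V) norm_UniformSpace_mixin)
    V.

Lemma N_ball_norm (x y : norm_NormedModuleAux) (e : posreal) :
  ball x e y -> N (minus y x) < 1 * e.
Proof. rewrite Rmult_1_l; exact (fun H => H). Qed.

Definition norm_NormedModule_mixin :
    NormedModule.mixin_of K norm_NormedModuleAux :=
  NormedModule.Mixin K norm_NormedModuleAux N 1 N_plus N_scal
    (fun _ _ _ H => H) N_ball_norm N_eq0.

Definition NormedModule_of_norm : NormedModule K :=
  NormedModule.Pack K V
    (NormedModule.Class K V (NormedModuleAux.class K norm_NormedModuleAux)
       norm_NormedModule_mixin) V.

End NormedModuleOfNorm.

Section Dual.

Context {k : scalar_field} (X : NormedModule k).

(* [is_linear] comprises additivity, homogeneity over the scalars and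
   boundedness, i.e. continuity. *)
Record dual_elt := Dual {
  dual_fun :> X -> k;
  dual_is_linear : is_linear (V := AbsRing_NormedModule k) dual_fun }.

Lemma dual_eq (f g : dual_elt) : (forall x, f x = g x) -> f = g.
Proof.
destruct f as [f Hf], g as [g Hg]; simpl; intros H.
assert (f = g) as -> by (apply functional_extensionality, H).
f_equal; apply proof_irrelevance.
Qed.

Lemma dual_plus_linear (f g : dual_elt) :
  is_linear (V := AbsRing_NormedModule k) (fun x => plus (f x) (g x)).
Proof.
exact (is_linear_comp _ _
  (is_linear_prod _ _ (dual_is_linear f) (dual_is_linear g))
  (is_linear_plus (V := AbsRing_NormedModule k))).
Qed.

Lemma dual_scal_linear (c : k) (f : dual_elt) :
  is_linear (V := AbsRing_NormedModule k) (fun x => mult c (f x)).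
Proof.
exact (is_linear_comp _ _ (dual_is_linear f)
  (is_linear_scal_r (V := AbsRing_NormedModule k) c (scalars_mult_comm k))).
Qed.

Lemma dual_opp_linear (f : dual_elt) :
  is_linear (V := AbsRing_NormedModule k) (fun x => opp (f x)).
Proof.
exact (is_linear_comp _ _ (dual_is_linear f)
  (is_linear_opp (V := AbsRing_NormedModule k))).
Qed.

Definition dual_plus (f g : dual_elt) := Dual _ (dual_plus_linear f g).
Definition dual_opp (f : dual_elt) := Dual _ (dual_opp_linear f).
Definition dual_scal (c : k) (f : dual_elt) := Dual _ (dual_scal_linear c f).
Definition dual_zero :=
  Dual (fun _ => zero) (is_linear_zero (V := AbsRing_NormedModule k)).

Definition dual_AbelianMonoid_mixin : AbelianMonoid.mixin_of dual_elt.
Proof.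
apply (AbelianMonoid.Mixin dual_elt dual_plus dual_zero).
- intros f g; apply dual_eq; intros x; apply plus_comm.
- intros f g h; apply dual_eq; intros x; apply plus_assoc.
- intros f; apply dual_eq; intros x; apply plus_zero_r.
Defined.

Canonical dual_AbelianMonoid :=
  AbelianMonoid.Pack dual_elt dual_AbelianMonoid_mixin dual_elt.

Definition dual_AbelianGroup_mixin : AbelianGroup.mixin_of dual_AbelianMonoid.
Proof.
apply (AbelianGroup.Mixin dual_AbelianMonoid dual_opp).
intros f; apply dual_eq; intros x; apply (plus_opp_r (f x)).
Defined.

Canonical dual_AbelianGroup :=
  AbelianGroup.Pack dual_elt
    (AbelianGroup.Class _ dual_AbelianMonoid_mixin dual_AbelianGroup_mixin)
    dual_elt.

Definition dual_ModuleSpace_mixin : ModuleSpace.mixin_of k dual_AbelianGroup.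
Proof.
apply (ModuleSpace.Mixin k dual_AbelianGroup dual_scal).
- intros c d f; apply dual_eq; intros x; apply mult_assoc.
- intros f; apply dual_eq; intros x; apply mult_one_l.
- intros c f g; apply dual_eq; intros x.
  exact (mult_distr_l c (dual_fun f x) (dual_fun g x)).
- intros c d f; apply dual_eq; intros x; exact (mult_distr_r c d (dual_fun f x)).
Defined.

Canonical dual_ModuleSpace :=
  ModuleSpace.Pack k dual_elt
    (ModuleSpace.Class k dual_elt (AbelianGroup.class dual_AbelianGroup)
       dual_ModuleSpace_mixin) dual_elt.

Definition dual_norm (f : dual_elt) : R :=
  real (Lub_Rbar (fun r => exists x : X, norm x <= 1 /\ r = abs (f x))).

Lemma dual_norm_ub (f : dual_elt) (x : X) :
  norm x <= 1 -> abs (f x) <= dual_norm f.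
Proof.
intros Hx; unfold dual_norm.
set (E := fun r => _).
destruct (Lub_Rbar_correct E) as [Hub Hleast].
pose proof (Hub _ (ex_intro _ x (conj Hx eq_refl))) as H.
destruct (linear_norm _ (dual_is_linear f)) as (M & HM & HfM).
assert (HbM : is_ub_Rbar E M).
{ intros r (y & Hy & ->); simpl.
  eapply Rle_trans; [apply (HfM y)|].
  rewrite <- (Rmult_1_r M) at 2.
  apply Rmult_le_compat_l; lra. }
pose proof (Hleast _ HbM) as H'.
destruct (Lub_Rbar E); simpl in *; tauto.
Qed.

Lemma dual_norm_le (f : dual_elt) (M : R) :
  (forall x : X, norm x <= 1 -> abs (f x) <= M) -> dual_norm f <= M.
Proof.
intros HM; unfold dual_norm.
set (E := fun r => _).
destruct (Lub_Rbar_correct E) as [Hub Hleast].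
assert (HbM : is_ub_Rbar E M).
{ intros r (y & Hy & ->); apply HM, Hy. }
pose proof (Hleast _ HbM) as H'.
assert (H0 : E (abs (f zero))).
{ exists zero; split; [rewrite norm_zero; lra | reflexivity]. }
apply Hub in H0.
destruct (Lub_Rbar E); simpl in *; tauto.
Qed.

Lemma dual_norm_plus (f g : dual_elt) :
  dual_norm (dual_plus f g) <= dual_norm f + dual_norm g.
Proof.
apply dual_norm_le; intros x Hx; simpl.
eapply Rle_trans; [apply abs_triangle|].
apply Rplus_le_compat; apply dual_norm_ub, Hx.
Qed.

Lemma dual_norm_scal (c : k) (f : dual_elt) :
  dual_norm (dual_scal c f) <= abs c * dual_norm f.
Proof.
apply dual_norm_le; intros x Hx; simpl.
eapply Rle_trans; [apply abs_mult|].
apply Rmult_le_compat_l; [apply abs_ge_0 | apply dual_norm_ub, Hx].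
Qed.

Lemma dual_norm_eq0 (f : dual_elt) : dual_norm f = 0 -> f = dual_zero.
Proof.
intros H0; apply dual_eq; intros x; simpl.
destruct (scalars_real_mult k (norm x + 1)) as (c & d & Hcd & Hc & Hd).
{ pose proof (norm_ge_0 x); lra. }
assert (Hdx : norm (scal d x) <= 1).
{ eapply Rle_trans; [apply norm_scal|]; rewrite Hd.
  pose proof (norm_ge_0 x).
  apply Rmult_le_reg_l with (norm x + 1); [lra|].
  field_simplify; lra. }
pose proof (dual_norm_ub f _ Hdx) as Hle.
rewrite H0 in Hle.
assert (Hz : f (scal d x) = zero).
{ apply abs_eq_zero, Rle_antisym; [exact Hle | apply abs_ge_0]. }
rewrite (linear_scal _ (dual_is_linear f)) in Hz.
transitivity (mult c (mult d (f x))).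
- now rewrite mult_assoc, Hcd, mult_one_l.
- change (mult d (f x) = zero) in Hz; rewrite Hz; exact (mult_zero_r c).
Qed.

Definition dual : NormedModule k :=
  NormedModule_of_norm k dual_ModuleSpace dual_norm
    dual_norm_plus dual_norm_scal dual_norm_eq0.

End Dual.

Arguments Dual {k X} _ _.
Arguments dual_fun {k X} _ _.

(* The indices p of the direct sums: 0, a real p >= 1, or infinity. *)
Inductive exponent :=
  | Zero
  | Lebesgue (p : R) (hp : 1 <= p)
  | Infinity.

(* [Rpower 0 p] is not 0 ([ln 0 = 0] in the standard library). *)
Definition rpow (x p : R) : R := if Rlt_dec 0 x then Rpower x p else 0.

(* The conditions and norms below are applied to sequences of norms. *)
Definition summable (e : exponent) (a : nat -> R) : Prop :=
  match e with
  | Zero => is_lim_seq a 0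
  | Lebesgue p _ => ex_series (fun n => rpow (a n) p)
  | Infinity => Rbar_lt (Sup_seq a) p_infty
  end.

(* For [Zero] the supremum is a maximum: see [lnorm_zero_max]. *)
Definition lnorm (e : exponent) (a : nat -> R) : R :=
  match e with
  | Zero => real (Sup_seq a)
  | Lebesgue p _ => rpow (Series (fun n => rpow (a n) p)) (/ p)
  | Infinity => real (Sup_seq a)
  end.

Lemma rpow_pos (x p : R) : 0 < x -> rpow x p = Rpower x p.
Proof. intros; unfold rpow; destruct (Rlt_dec 0 x); lra. Qed.

Lemma rpow_0 (p : R) : rpow 0 p = 0.
Proof. unfold rpow; destruct (Rlt_dec 0 0); lra. Qed.

Lemma rpow_gt0 (x p : R) : 0 < x -> 0 < rpow x p.
Proof. intros; rewrite rpow_pos by trivial; apply exp_pos. Qed.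

Lemma rpow_ge0 (x p : R) : 0 <= rpow x p.
Proof.
unfold rpow; destruct (Rlt_dec 0 x); [apply Rlt_le, exp_pos | lra].
Qed.

Lemma rpow_le (x y p : R) : 0 < p -> x <= y -> rpow x p <= rpow y p.
Proof.
intros Hp Hxy.
destruct (Rlt_dec 0 x) as [Hx|Hx].
- rewrite !rpow_pos by lra; apply Rle_Rpower_l; lra.
- unfold rpow at 1; destruct (Rlt_dec 0 x); [lra | apply rpow_ge0].
Qed.

Lemma rpow_mult (x y p : R) :
  0 <= x -> 0 <= y -> rpow (x * y) p = rpow x p * rpow y p.
Proof.
intros [Hx|<-] [Hy|<-]; rewrite ?Rmult_0_l, ?Rmult_0_r, ?rpow_0; try ring.
rewrite !rpow_pos by (try apply Rmult_lt_0_compat; trivial).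
symmetry; now apply Rpower_mult_distr.
Qed.

Lemma rpow_inv (x p q : R) : p * q = 1 -> 0 <= x -> rpow (rpow x p) q = x.
Proof.
intros Hpq [Hx|<-]; [|now rewrite !rpow_0].
rewrite (rpow_pos _ q) by (now apply rpow_gt0).
rewrite rpow_pos by trivial.
now rewrite Rpower_mult, Hpq, Rpower_1.
Qed.

Lemma rpow_tangent (y p : R) : 0 <= y -> 1 <= p -> 1 + p * (y - 1) <= rpow y p.
Proof.
intros [Hy|<-] Hp; [|rewrite rpow_0; lra].
rewrite rpow_pos by trivial; unfold Rpower.
set (L := ln y).
rewrite <- (exp_ln y Hy); fold L.
replace (p * L) with (L + (p - 1) * L) by ring.
rewrite exp_plus.
pose proof (exp_pos L) as HL.
pose proof (exp_ineq1_le ((p - 1) * L)) as H1.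
pose proof (exp_ineq1_le (- L)) as H2.
assert (H3 : exp L * exp (- L) = 1)
  by (rewrite <- exp_plus, Rplus_opp_r; apply exp_0).
assert (H4 : exp L * (1 + (p - 1) * L) <= exp L * exp ((p - 1) * L))
  by (apply Rmult_le_compat_l; lra).
assert (H5 : (p - 1) * (exp L * (1 + - L)) <= (p - 1) * (exp L * exp (- L))).
{ apply Rmult_le_compat_l; [lra|]; apply Rmult_le_compat_l; lra. }
rewrite H3 in H5; nra.
Qed.

Lemma rpow_convex (t u v p : R) :
  0 <= t <= 1 -> 0 <= u -> 0 <= v -> 1 <= p ->
  rpow (t * u + (1 - t) * v) p <= t * rpow u p + (1 - t) * rpow v p.
Proof.
intros Ht Hu Hv Hp.
set (m := t * u + (1 - t) * v).
assert (Hm : 0 <= m) by (unfold m; nra).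
destruct Hm as [Hm|Hm].
2: { rewrite <- Hm, rpow_0.
     pose proof (rpow_ge0 u p); pose proof (rpow_ge0 v p); nra. }
assert (Hw : forall w, 0 <= w ->
          rpow m p * (1 + p * (w / m - 1)) <= rpow w p).
{ intros w Hw.
  assert (Hwm : 0 <= w / m) by (apply Rdiv_le_0_compat; trivial).
  replace w with (m * (w / m)) at 2 by (field; lra).
  rewrite rpow_mult by lra.
  apply Rmult_le_compat_l; [apply rpow_ge0|].
  now apply rpow_tangent. }
pose proof (Rmult_le_compat_l t _ _ (proj1 Ht) (Hw u Hu)) as H1.
assert (Ht' : 0 <= 1 - t) by lra.
pose proof (Rmult_le_compat_l (1 - t) _ _ Ht' (Hw v Hv)) as H2.
eapply Rle_trans; [|apply (Rplus_le_compat _ _ _ _ H1 H2)].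
right; replace (t * (rpow m p * (1 + p * (u / m - 1)))
  + (1 - t) * (rpow m p * (1 + p * (v / m - 1))))
  with (rpow m p * (1 + p * ((t * u + (1 - t) * v) / m - 1)))
  by (field; lra).
fold m; field; lra.
Qed.

Lemma ex_series_dominated (a b : nat -> R) :
  (forall n, 0 <= a n <= b n) -> ex_series b -> ex_series a.
Proof.
intros H; apply (ex_series_le (V := R_CompleteNormedModule)).
intros n; change (Rabs (a n) <= b n); rewrite Rabs_pos_eq; apply H.
Qed.

Lemma Series_ge0 (a : nat -> R) :
  (forall n, 0 <= a n) -> ex_series a -> 0 <= Series a.
Proof.
intros Ha Hex.
rewrite <- (Rmult_0_l (Series a)), <- Series_scal_l.
apply Series_le; [|exact Hex].
intros n; pose proof (Ha n); lra.
Qed.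

Lemma Series_ge_term (a : nat -> R) (n : nat) :
  (forall n, 0 <= a n) -> ex_series a -> a n <= Series a.
Proof.
intros Ha Hex.
apply Rle_trans with (sum_n a n).
- destruct n; [rewrite sum_O; apply Rle_refl|].
  rewrite sum_Sn; change (plus (sum_n a n) (a (S n)))
    with (sum_n a n + a (S n)).
  enough (0 <= sum_n a n) by lra.
  induction n as [|n IH]; [rewrite sum_O; apply Ha|].
  rewrite sum_Sn; change (0 <= sum_n a n + a (S n)).
  specialize (Ha (S n)); lra.
- apply (is_lim_seq_incr_compare (sum_n a)).
  + apply Series_correct, Hex.
  + intros m; rewrite sum_Sn; change (sum_n a m <= sum_n a m + a (S m)).
    specialize (Ha (S m)); lra.
Qed.

Lemma Sup_seq_le_real (a : nat -> R) (M : R) :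
  (forall n, a n <= M) -> Rbar_lt (Sup_seq a) p_infty /\ real (Sup_seq a) <= M.
Proof.
intros HM.
assert (H : Rbar_le (Sup_seq a) M).
{ apply Rbar_not_lt_le; intros H.
  apply Sup_seq_minor_lt in H; destruct H as [n Hn].
  simpl in Hn; specialize (HM n); lra. }
pose proof (Sup_seq_minor_le a (a 0%nat) 0 (Rle_refl _)) as H0.
destruct (Sup_seq a); simpl in *; tauto.
Qed.

Lemma Sup_seq_ge_real (a : nat -> R) (n : nat) :
  Rbar_lt (Sup_seq a) p_infty -> a n <= real (Sup_seq a).
Proof.
intros H.
pose proof (Sup_seq_minor_le a (a n) n (Rle_refl _)) as H0.
destruct (Sup_seq a); simpl in *; tauto.
Qed.

Lemma summable_zero_bounded (a : nat -> R) :
  is_lim_seq a 0 -> Rbar_lt (Sup_seq a) p_infty.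
Proof.
intros H.
destruct (filterlim_bounded (V := R_NormedModule) a) as [M HM].
{ exists 0; exact H. }
apply (Sup_seq_le_real a M).
intros n; eapply Rle_trans; [apply Rle_abs | apply (HM n)].
Qed.

Lemma lnorm_zero_max (a : nat -> R) :
  (forall n, 0 <= a n) -> summable Zero a -> exists n, lnorm Zero a = a n.
Proof.
intros Ha Hlim; simpl in *.
pose proof (summable_zero_bounded a Hlim) as Hb.
pose proof (fun n => Sup_seq_ge_real a n Hb) as Hge.
destruct (Rle_lt_or_eq_dec 0 (real (Sup_seq a))) as [Hpos|Hz].
{ eapply Rle_trans; [apply (Ha 0%nat) | apply Hge]. }
2: { exists 0%nat; apply Rle_antisym; [rewrite <- Hz; apply Ha | apply Hge]. }
set (s := real (Sup_seq a)) in *.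
destruct (proj2 (is_lim_seq_spec a 0) Hlim (mkposreal (s / 2) ltac:(lra)))
  as [N HN]; simpl in HN.
assert (Hmax : forall N, exists m, forall n, (n <= N)%nat -> a n <= a m).
{ clear; intros N; induction N as [|N [m Hm]].
  - exists 0%nat; intros n Hn; replace n with 0%nat by lia; lra.
  - destruct (Rle_dec (a m) (a (S N))) as [H|H].
    + exists (S N); intros n Hn.
      destruct (Nat.eq_dec n (S N)) as [->|]; [lra|].
      apply Rle_trans with (a m); [apply Hm; lia | exact H].
    + exists m; intros n Hn.
      destruct (Nat.eq_dec n (S N)) as [->|]; [lra | apply Hm; lia]. }
destruct (Hmax N) as [m Hm].
exists m; apply Rle_antisym; [|apply Hge].
assert (Hs : forall M, (forall n, a n <= M) -> s <= M).
{ intros M HM; apply (Sup_seq_le_real a M HM). }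
destruct (Rle_dec (s / 2) (a m)) as [H|H].
- apply Hs; intros n; destruct (Nat.le_gt_cases n N) as [Hn|Hn].
  + now apply Hm.
  + specialize (HN n (Nat.lt_le_incl _ _ Hn)).
    rewrite Rminus_0_r, Rabs_pos_eq in HN by apply Ha; lra.
- exfalso.
  enough (s <= s / 2) by lra.
  apply Hs; intros n; destruct (Nat.le_gt_cases n N) as [Hn|Hn].
  + specialize (Hm n Hn); lra.
  + specialize (HN n (Nat.lt_le_incl _ _ Hn)).
    rewrite Rminus_0_r, Rabs_pos_eq in HN by apply Ha; lra.
Qed.

Lemma Lebesgue_Series (p : R) (hp : 1 <= p) (a : nat -> R) :
  summable (Lebesgue p hp) a ->
  Series (fun n => rpow (a n) p) = rpow (lnorm (Lebesgue p hp) a) p.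
Proof.
intros H; simpl; rewrite rpow_inv; [reflexivity | field; lra |].
apply Series_ge0; [intros; apply rpow_ge0 | exact H].
Qed.

Lemma Lebesgue_dominated (p : R) (hp : 1 <= p) (a d : nat -> R) (M : R) :
  0 <= M -> (forall n, rpow (a n) p <= d n) ->
  ex_series d -> Series d <= rpow M p ->
  summable (Lebesgue p hp) a /\ lnorm (Lebesgue p hp) a <= M.
Proof.
intros HM Had Hd HdM.
assert (H : forall n, 0 <= rpow (a n) p <= d n)
  by (split; [apply rpow_ge0 | apply Had]).
split; simpl; [exact (ex_series_dominated _ _ H Hd)|].
rewrite <- (rpow_inv M p (/ p)); [| field; lra | exact HM].
apply rpow_le; [apply Rinv_0_lt_compat; lra|].
eapply Rle_trans; [apply (Series_le _ _ H Hd) | exact HdM].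
Qed.

Lemma lnorm_ge0 (e : exponent) (a : nat -> R) :
  (forall n, 0 <= a n) -> summable e a -> 0 <= lnorm e a.
Proof.
intros Ha; destruct e as [|p hp|]; simpl; intros H.
- apply summable_zero_bounded in H.
  eapply Rle_trans; [apply (Ha 0%nat) | now apply Sup_seq_ge_real].
- apply rpow_ge0.
- eapply Rle_trans; [apply (Ha 0%nat) | now apply Sup_seq_ge_real].
Qed.

Lemma summable_zero (e : exponent) : summable e (fun _ => 0).
Proof.
destruct e as [|p hp|]; simpl.
- apply is_lim_seq_const.
- exists 0; apply is_series_ext with (fun _ => 0).
  + intros n; now rewrite rpow_0.
  + assert (H : is_lim_seq (sum_n (fun _ => 0)) 0); [|exact H].
    apply is_lim_seq_ext with (fun _ => 0); [|apply is_lim_seq_const].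
    intros n; rewrite sum_n_const; ring.
- apply (Sup_seq_le_real (fun _ => 0) 0); intros; lra.
Qed.

Lemma lnorm_scal (e : exponent) (l : R) (a c : nat -> R) :
  0 <= l -> (forall n, 0 <= a n) -> (forall n, 0 <= c n <= l * a n) ->
  summable e a -> summable e c /\ lnorm e c <= l * lnorm e a.
Proof.
intros Hl Ha Hc.
assert (Hsup : Rbar_lt (Sup_seq a) p_infty ->
  Rbar_lt (Sup_seq c) p_infty /\ real (Sup_seq c) <= l * real (Sup_seq a)).
{ intros H; apply Sup_seq_le_real; intros n.
  eapply Rle_trans; [apply Hc|].
  apply Rmult_le_compat_l; [exact Hl | now apply Sup_seq_ge_real]. }
destruct e as [|p hp|]; intros H.
- split; [|apply Hsup, summable_zero_bounded, H].
  simpl in *; apply (is_lim_seq_le_le (fun _ => 0) c (fun n => l * a n)).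
  + exact Hc.
  + apply is_lim_seq_const.
  + replace (Finite 0) with (Rbar_mult l 0) by (simpl; f_equal; ring).
    now apply is_lim_seq_scal_l.
- apply Lebesgue_dominated with (fun n => rpow l p * rpow (a n) p).
  + apply Rmult_le_pos; [exact Hl | now apply lnorm_ge0].
  + intros n; rewrite <- rpow_mult by auto.
    apply rpow_le; [lra | apply Hc].
  + exact (ex_series_scal_l (rpow l p) _ H).
  + rewrite Series_scal_l, (Lebesgue_Series p hp a H).
    rewrite rpow_mult; [lra | exact Hl | now apply lnorm_ge0].
- now apply Hsup.
Qed.

Lemma lnorm_plus (e : exponent) (a b c : nat -> R) :
  (forall n, 0 <= a n) -> (forall n, 0 <= b n) ->
  (forall n, 0 <= c n <= a n + b n) ->
  summable e a -> summable e b ->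
  summable e c /\ lnorm e c <= lnorm e a + lnorm e b.
Proof.
intros Ha Hb Hc.
assert (Hsup : Rbar_lt (Sup_seq a) p_infty -> Rbar_lt (Sup_seq b) p_infty ->
  Rbar_lt (Sup_seq c) p_infty /\
  real (Sup_seq c) <= real (Sup_seq a) + real (Sup_seq b)).
{ intros H1 H2; apply Sup_seq_le_real; intros n.
  eapply Rle_trans; [apply Hc|].
  apply Rplus_le_compat; now apply Sup_seq_ge_real. }
destruct e as [|p hp|]; intros H1 H2.
- split; [|apply Hsup; now apply summable_zero_bounded].
  simpl in *; apply (is_lim_seq_le_le (fun _ => 0) c (fun n => a n + b n)).
  + exact Hc.
  + apply is_lim_seq_const.
  + replace (Finite 0) with (Rbar_plus 0 0) by (simpl; f_equal; ring).
    now apply is_lim_seq_plus'.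
- set (A := lnorm _ a); set (B := lnorm _ b).
  assert (HA : 0 <= A) by now apply lnorm_ge0.
  assert (HB : 0 <= B) by now apply lnorm_ge0.
  assert (Hmain : forall s t, A < s -> B < t ->
    summable (Lebesgue p hp) c /\ lnorm (Lebesgue p hp) c <= s + t).
  { intros s t Hs Ht.
    set (al := rpow (s + t) p * (s / (s + t)) / rpow s p).
    set (be := rpow (s + t) p * (t / (s + t)) / rpow t p).
    assert (Hs0 : 0 < rpow s p) by (apply rpow_gt0; lra).
    assert (Ht0 : 0 < rpow t p) by (apply rpow_gt0; lra).
    assert (Hst0 : 0 < rpow (s + t) p) by (apply rpow_gt0; lra).
    assert (Hsst : 0 <= s / (s + t)) by (apply Rdiv_le_0_compat; lra).
    assert (Htst : 0 <= t / (s + t)) by (apply Rdiv_le_0_compat; lra).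
    assert (Hal : 0 <= al).
    { apply Rdiv_le_0_compat; [|exact Hs0].
      apply Rmult_le_pos; [lra | exact Hsst]. }
    assert (Hbe : 0 <= be).
    { apply Rdiv_le_0_compat; [|exact Ht0].
      apply Rmult_le_pos; [lra | exact Htst]. }
    pose proof (ex_series_scal_l al _ H1) as E1.
    pose proof (ex_series_scal_l be _ H2) as E2.
    apply Lebesgue_dominated
      with (fun n => al * rpow (a n) p + be * rpow (b n) p).
    - lra.
    - intros n.
      apply Rle_trans with (rpow (a n + b n) p);
        [apply rpow_le; [lra | apply Hc]|].
      pose proof (Ha n) as Han; pose proof (Hb n) as Hbn.
      assert (Has : 0 <= a n / s) by (apply Rdiv_le_0_compat; lra).
      assert (Hbt : 0 <= b n / t) by (apply Rdiv_le_0_compat; lra).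
      replace (a n + b n) with
        ((s + t) * (s / (s + t) * (a n / s) + (1 - s / (s + t)) * (b n / t)))
        by (field; lra).
      assert (Hle1 : 0 <= 1 - s / (s + t))
        by (replace (1 - s / (s + t)) with (t / (s + t)) by (field; lra); lra).
      rewrite rpow_mult;
        [|lra|apply Rplus_le_le_0_compat; apply Rmult_le_pos; lra].
      eapply Rle_trans;
        [apply Rmult_le_compat_l; [lra | apply rpow_convex; lra]|].
      right.
      replace (rpow (a n) p) with (rpow s p * rpow (a n / s) p)
        by (rewrite <- rpow_mult by lra; f_equal; field; lra).
      replace (rpow (b n) p) with (rpow t p * rpow (b n / t) p)
        by (rewrite <- rpow_mult by lra; f_equal; field; lra).
      unfold al, be; field; lra.
    - exact (ex_series_plus _ _ E1 E2).
    - rewrite Series_plus by assumption.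
      rewrite !Series_scal_l.
      rewrite (Lebesgue_Series p hp a H1), (Lebesgue_Series p hp b H2).
      fold A B.
      assert (LA : rpow A p <= rpow s p) by (apply rpow_le; lra).
      assert (LB : rpow B p <= rpow t p) by (apply rpow_le; lra).
      eapply Rle_trans; [apply Rplus_le_compat;
        apply Rmult_le_compat_l; [exact Hal | exact LA | exact Hbe | exact LB]|].
      right; unfold al, be; field; lra. }
  split; [apply (Hmain (A + 1) (B + 1)); lra|].
  apply le_epsilon; intros eps Heps.
  replace (A + B + eps) with ((A + eps / 2) + (B + eps / 2)) by field.
  apply Hmain; lra.
- now apply Hsup.
Qed.

Lemma lnorm_eq0 (e : exponent) (a : nat -> R) :
  (forall n, 0 <= a n) -> summable e a -> lnorm e a = 0 -> forall n, a n = 0.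
Proof.
intros Ha; destruct e as [|p hp|]; intros H H0 n.
- apply Rle_antisym; [|apply Ha].
  rewrite <- H0; apply Sup_seq_ge_real, summable_zero_bounded, H.
- pose proof (Lebesgue_Series p hp a H) as HS.
  rewrite H0, rpow_0 in HS.
  pose proof (Series_ge_term _ n (fun n => rpow_ge0 (a n) p) H) as Hn.
  simpl in Hn; rewrite HS in Hn.
  destruct (Ha n) as [Hpos|]; [|auto].
  pose proof (rpow_gt0 _ p Hpos); lra.
- apply Rle_antisym; [|apply Ha].
  rewrite <- H0; apply Sup_seq_ge_real, H.
Qed.

Section DirectSum.

Context {K : AbsRing} (e : exponent) (X : nat -> NormedModule K).

Record direct_sum_elt := DirectSum {
  direct_sum_seq :> forall n, X n;
  direct_sum_summable : summable e (fun n => norm (direct_sum_seq n)) }.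

Lemma direct_sum_eq (x y : direct_sum_elt) : (forall n, x n = y n) -> x = y.
Proof.
destruct x as [x Hx], y as [y Hy]; simpl; intros H.
assert (x = y) as -> by (apply functional_extensionality_dep, H).
f_equal; apply proof_irrelevance.
Qed.

Definition direct_sum_norm (x : direct_sum_elt) : R :=
  lnorm e (fun n => norm (x n)).

Lemma direct_sum_plus_lnorm (x y : direct_sum_elt) :
  summable e (fun n => norm (plus (x n) (y n))) /\
  lnorm e (fun n => norm (plus (x n) (y n))) <=
    direct_sum_norm x + direct_sum_norm y.
Proof.
apply lnorm_plus; try apply direct_sum_summable;
  intros n; try apply norm_ge_0.
split; [apply norm_ge_0 | apply norm_triangle].
Qed.

Lemma direct_sum_scal_lnorm (c : K) (x : direct_sum_elt) :
  summable e (fun n => norm (scal c (x n))) /\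
  lnorm e (fun n => norm (scal c (x n))) <= abs c * direct_sum_norm x.
Proof.
apply lnorm_scal; try apply direct_sum_summable; try apply abs_ge_0;
  intros n; try apply norm_ge_0.
split; [apply norm_ge_0 | apply norm_scal].
Qed.

Lemma direct_sum_opp_summable (x : direct_sum_elt) :
  summable e (fun n => norm (opp (x n))).
Proof.
replace (fun n => norm (opp (x n))) with (fun n => norm (x n));
  [apply direct_sum_summable|].
apply functional_extensionality; intros n; now rewrite norm_opp.
Qed.

Lemma direct_sum_zero_summable : summable e (fun n => norm (zero : X n)).
Proof.
replace (fun n => norm (zero : X n)) with (fun _ : nat => 0);
  [apply summable_zero|].
apply functional_extensionality; intros n; now rewrite norm_zero.
Qed.

Definition direct_sum_plus (x y : direct_sum_elt) :=
  DirectSum (fun n => plus (x n) (y n)) (proj1 (direct_sum_plus_lnorm x y)).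
Definition direct_sum_opp (x : direct_sum_elt) :=
  DirectSum (fun n => opp (x n)) (direct_sum_opp_summable x).
Definition direct_sum_scal (c : K) (x : direct_sum_elt) :=
  DirectSum (fun n => scal c (x n)) (proj1 (direct_sum_scal_lnorm c x)).
Definition direct_sum_zero :=
  DirectSum (fun n => zero) direct_sum_zero_summable.

Definition direct_sum_AbelianMonoid_mixin :
  AbelianMonoid.mixin_of direct_sum_elt.
Proof.
apply (AbelianMonoid.Mixin direct_sum_elt direct_sum_plus direct_sum_zero).
- intros x y; apply direct_sum_eq; intros n; apply plus_comm.
- intros x y z; apply direct_sum_eq; intros n; apply plus_assoc.
- intros x; apply direct_sum_eq; intros n; apply plus_zero_r.
Defined.

Canonical direct_sum_AbelianMonoid :=
  AbelianMonoid.Pack direct_sum_elt direct_sum_AbelianMonoid_mixin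
    direct_sum_elt.

Definition direct_sum_AbelianGroup_mixin :
  AbelianGroup.mixin_of direct_sum_AbelianMonoid.
Proof.
apply (AbelianGroup.Mixin direct_sum_AbelianMonoid direct_sum_opp).
intros x; apply direct_sum_eq; intros n; apply (plus_opp_r (x n)).
Defined.

Canonical direct_sum_AbelianGroup :=
  AbelianGroup.Pack direct_sum_elt
    (AbelianGroup.Class _ direct_sum_AbelianMonoid_mixin
       direct_sum_AbelianGroup_mixin) direct_sum_elt.

Definition direct_sum_ModuleSpace_mixin :
  ModuleSpace.mixin_of K direct_sum_AbelianGroup.
Proof.
apply (ModuleSpace.Mixin K direct_sum_AbelianGroup direct_sum_scal).
- intros c d x; apply direct_sum_eq; intros n; apply scal_assoc.
- intros x; apply direct_sum_eq; intros n; apply scal_one.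
- intros c x y; apply direct_sum_eq; intros n.
  exact (scal_distr_l c (direct_sum_seq x n) (direct_sum_seq y n)).
- intros c d x; apply direct_sum_eq; intros n.
  exact (scal_distr_r c d (direct_sum_seq x n)).
Defined.

Canonical direct_sum_ModuleSpace :=
  ModuleSpace.Pack K direct_sum_elt
    (ModuleSpace.Class K direct_sum_elt
       (AbelianGroup.class direct_sum_AbelianGroup)
       direct_sum_ModuleSpace_mixin) direct_sum_elt.

Lemma direct_sum_norm_eq0 (x : direct_sum_elt) :
  direct_sum_norm x = 0 -> x = direct_sum_zero.
Proof.
intros H; apply direct_sum_eq; intros n; apply norm_eq_zero.
apply (lnorm_eq0 e (fun n => norm (x n))); trivial.
- intros m; apply norm_ge_0.
- apply direct_sum_summable.
Qed.

Definition direct_sum : NormedModule K :=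
  NormedModule_of_norm K direct_sum_ModuleSpace direct_sum_norm
    (fun x y => proj2 (direct_sum_plus_lnorm x y))
    (fun c x => proj2 (direct_sum_scal_lnorm c x))
    direct_sum_norm_eq0.

End DirectSum.

Arguments DirectSum {K e X} _ _.
Arguments direct_sum_seq {K e X} _ _.

(* 1/p + 1/q = 1 with the convention 1/infinity = 0 if p >= 1, and q = 1 if
   p = 0. *)
Definition dual_exponents (p q : exponent) : Prop :=
  match p, q with
  | Lebesgue p _, Lebesgue q _ => / p + / q = 1
  | Lebesgue p _, Infinity => / p + 0 = 1
  | Zero, Lebesgue q _ => q = 1
  | _, _ => False
  end.

Definition nontrivial {K : AbsRing} (V : NormedModule K) : Prop :=
  exists x : V, x <> zero.

Record isometric_isomorphism {K : AbsRing} {V W : NormedModule K}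
    (T : V -> W) : Prop := {
  isom_plus : forall x y : V, T (plus x y) = plus (T x) (T y);
  isom_scal : forall (c : K) (x : V), T (scal c x) = scal c (T x);
  isom_norm : forall x : V, norm (T x) = norm x;
  isom_bij : forall y : W, exists! x : V, T x = y }.

(* Main.v *)
Require Import Defs.
From Stdlib Require Import Reals Lra Lia Classical ClassicalEpsilon.
From Stdlib Require Import FunctionalExtensionality Eqdep_dec.
From Coquelicot Require Import Coquelicot.
Open Scope R_scope.

(** Hoelder's inequality makes [f n (x n)] summable with
    [|T f x| <= ||f||_q ||x||_p].  Conversely, let [g] be in the dual of the
    p-sum and let [g_n] be its restriction to the n-th summand.  Choosing
    [y_n] in [X n] with [||y_n|| <= a_n] and [g_n y_n] real and almost
    [a_n ||g_n||], for a finitely supported [a >= 0], gives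
    [sum a_n ||g_n|| <= ||g|| ||a||_p]; the extremal choice of [a] in Hoelder's
    inequality then yields [||(g_n)||_q <= ||g||].  Since [p] is not infinity,
    the truncations of [x] converge to [x], so [g x = sum g_n (x n)], and [T] is
    onto.  The estimate applied to [g = T f] shows that [T] is isometric. *)

(** * Real powers and Young's inequality *)

Lemma rpow_1_r (x : R) : 0 <= x -> rpow x 1 = x.
Proof.
intros [Hx|<-]; [now rewrite rpow_pos, Rpower_1 | apply rpow_0].
Qed.

Lemma rpow_1_l (p : R) : rpow 1 p = 1.
Proof.
rewrite rpow_pos by lra; unfold Rpower.
rewrite ln_1, Rmult_0_r; apply exp_0.
Qed.

Lemma rpow_rpow (x p q : R) : rpow (rpow x p) q = rpow x (p * q).
Proof.
destruct (Rlt_dec 0 x) as [Hx|Hx].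
- rewrite (rpow_pos _ q) by (now apply rpow_gt0).
  rewrite !rpow_pos by trivial; apply Rpower_mult.
- unfold rpow at 2 3; destruct (Rlt_dec 0 x); [easy | apply rpow_0].
Qed.

Lemma rpow_plus (x p q : R) : rpow x (p + q) = rpow x p * rpow x q.
Proof.
unfold rpow; destruct (Rlt_dec 0 x); [apply Rpower_plus | ring].
Qed.

Lemma young_inequality (x y p q : R) :
  0 <= x -> 0 <= y -> 1 <= p -> 1 <= q -> / p + / q = 1 ->
  x * y <= / p * rpow x p + / q * rpow y q.
Proof.
intros Hx [Hy|<-] Hp Hq Hpq.
2: { rewrite rpow_0, Rmult_0_r, Rmult_0_r, Rplus_0_r.
     apply Rmult_le_pos; [apply Rlt_le, Rinv_0_lt_compat; lra | apply rpow_ge0]. }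
(* The tangent inequality at w = x / y^(q/p). *)
set (s := rpow y (q * / p)).
assert (Hs : 0 < s) by (now apply rpow_gt0).
set (w := x / s).
assert (Hw : 0 <= w) by (apply Rdiv_le_0_compat; trivial).
assert (Hsp : rpow s p = rpow y q).
{ unfold s; rewrite rpow_rpow; f_equal; field; lra. }
assert (Hsy : rpow y q = s * y).
{ rewrite <- (rpow_1_r y) at 2 by lra; unfold s; rewrite <- rpow_plus.
  f_equal; replace (/ p) with (1 - / q) by lra; field; lra. }
assert (Hxp : rpow x p = rpow w p * rpow y q).
{ rewrite <- Hsp, <- rpow_mult by lra; f_equal; unfold w; field; lra. }
pose proof (rpow_tangent w p Hw Hp) as Ht.
replace (x * y) with (w * rpow y q) by (rewrite Hsy; unfold w; field; lra).
rewrite Hxp; replace (/ q) with (1 - / p) by lra.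
(* Divided by [p], the tangent inequality reads [w - / q <= / p * rpow w p]; multiplied by
   [rpow y q] it becomes the claim. *)
apply Rmult_le_compat_l with (r := / p) in Ht;
  [|apply Rlt_le, Rinv_0_lt_compat; lra].
replace (/ p * (1 + p * (w - 1))) with (/ p + w - 1) in Ht by (field; lra).
pose proof (rpow_ge0 y q); nra.
Qed.

(** Norms that may vanish are first replaced by strictly larger numbers, by which one can divide;
    this lemma returns to the norms themselves. *)
Lemma Rle_mult_limit (S A B : R) :
  0 <= A -> 0 <= B -> (forall s t, A < s -> B < t -> S <= s * t) -> S <= A * B.
Proof.
intros HA HB H; apply Rnot_lt_le; intros Hlt.
set (D := S - A * B).
assert (HD : 0 < D) by (unfold D; lra).
(* Since [e <= 1], [(A + e) * (B + e) <= A * B + e * (A + B + 1)], and this [e] keeps the last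
   summand strictly below [D = S - A * B]. *)
set (e := D / (A + B + 1 + D)).
assert (He : 0 < e) by (apply Rdiv_lt_0_compat; lra).
assert (HeD : e * (A + B + 1) = D - e * D) by (unfold e; field; lra).
assert (He1 : e <= 1).
{ apply Rmult_le_reg_r with (A + B + 1 + D); [lra|].
  unfold e; field_simplify; lra. }
pose proof (H (A + e) (B + e) ltac:(lra) ltac:(lra)).
unfold D in *; nra.
Qed.

(** * Finite sums and finitely supported sequences *)

Lemma sum_n_S_R (a : nat -> R) (n : nat) : sum_n a (S n) = sum_n a n + a (S n).
Proof. exact (sum_Sn a n). Qed.

Lemma sum_n_le (a b : nat -> R) (N : nat) :
  (forall n, (n <= N)%nat -> a n <= b n) -> sum_n a N <= sum_n b N.
Proof.
induction N as [|N IH]; intros H.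
- rewrite !sum_O; now apply H.
- rewrite !sum_n_S_R; apply Rplus_le_compat; [apply IH; auto | now apply H].
Qed.

Lemma sum_n_mult_minus (a b : nat -> R) (c : R) (N : nat) :
  sum_n (fun n => a n * (b n - c)) N =
  sum_n (fun n => a n * b n) N - c * sum_n a N :> R.
Proof.
induction N as [|N IH].
- rewrite !sum_O; unfold Rminus; ring.
- rewrite !sum_n_S_R, IH; ring.
Qed.

Lemma Series_le_bound (a : nat -> R) (M : R) :
  (forall n, 0 <= a n) -> (forall N, sum_n a N <= M) ->
  ex_series a /\ Series a <= M.
Proof.
intros Ha HM.
assert (Hex : ex_series a).
{ destruct (ex_finite_lim_seq_incr (sum_n a) M) as [l Hl]; [|exact HM|].
  - intros n; rewrite sum_n_S_R; specialize (Ha (S n)); lra.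
  - now exists l. }
split; [exact Hex|].
exact (is_lim_seq_le _ (fun _ => M) (Series a) M HM (Series_correct _ Hex)
  (is_lim_seq_const M)).
Qed.

Lemma is_series_finite {K : AbsRing} {V : NormedModule K} (a : nat -> V) (N : nat) :
  (forall n, (N < n)%nat -> a n = zero) -> is_series a (sum_n a N).
Proof.
intros Ha; unfold is_series.
apply filterlim_ext_loc with (fun _ => sum_n a N); [|apply filterlim_const].
exists N; intros n Hn; induction Hn as [|n Hn IH]; [reflexivity|].
rewrite sum_Sn, Ha, plus_zero_r by lia; exact IH.
Qed.

Lemma summable_finite (e : exponent) (a : nat -> R) (N : nat) :
  (forall n, (N < n)%nat -> a n = 0) -> summable e a.
Proof.
intros Ha; destruct e as [|p hp|]; simpl.
- apply is_lim_seq_ext_loc with (fun _ => 0); [|apply is_lim_seq_const].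
  exists (S N); intros n Hn; now rewrite Ha.
- exists (sum_n (fun n => rpow (a n) p) N).
  apply (is_series_finite (V := R_NormedModule)); intros n Hn; rewrite Ha by trivial; apply rpow_0.
- apply summable_zero_bounded.
  apply is_lim_seq_ext_loc with (fun _ => 0); [|apply is_lim_seq_const].
  exists (S N); intros n Hn; now rewrite Ha.
Qed.

Lemma lnorm_Lebesgue_finite (p : R) (hp : 1 <= p) (a : nat -> R) (N : nat) :
  (forall n, (N < n)%nat -> a n = 0) ->
  lnorm (Lebesgue p hp) a = rpow (sum_n (fun n => rpow (a n) p) N) (/ p).
Proof.
intros Ha; simpl; f_equal; apply is_series_unique, (is_series_finite (V := R_NormedModule)).
intros n Hn; rewrite Ha by trivial; apply rpow_0.
Qed.

(** * Hoelder's inequality, its converse, and tails of summable sequences *)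

Lemma lnorm_Lebesgue_1 (h : 1 <= 1) (a : nat -> R) :
  (forall n, 0 <= a n) -> summable (Lebesgue 1 h) a ->
  ex_series a /\ lnorm (Lebesgue 1 h) a = Series a.
Proof.
intros Ha H; simpl in *.
assert (He : forall n, rpow (a n) 1 = a n) by (intros n; now apply rpow_1_r).
apply (ex_series_ext _ _ He) in H; split; [exact H|].
rewrite Rinv_1, (Series_ext _ _ He); now apply rpow_1_r, Series_ge0.
Qed.

(** The pairing of a bounded with an absolutely summable sequence; it settles Hoelder's inequality
    for p = 0 and, with the roles exchanged, for p = 1. *)
Lemma Series_mult_bounded (a b : nat -> R) (M : R) :
  (forall n, 0 <= a n <= M) -> (forall n, 0 <= b n) -> ex_series b ->
  ex_series (fun n => a n * b n) /\ Series (fun n => a n * b n) <= M * Series b.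
Proof.
intros Ha Hb H.
assert (Hab : forall n, 0 <= a n * b n <= M * b n).
{ intros n; pose proof (Ha n); pose proof (Hb n); nra. }
pose proof (ex_series_scal_l M _ H : ex_series (fun n => M * b n)) as HM.
split; [exact (ex_series_dominated _ _ Hab HM)|].
rewrite <- Series_scal_l; now apply Series_le.
Qed.

Lemma holder_inequality (p q : exponent) (a b : nat -> R) :
  dual_exponents p q -> (forall n, 0 <= a n) -> (forall n, 0 <= b n) ->
  summable p a -> summable q b ->
  ex_series (fun n => a n * b n) /\
  Series (fun n => a n * b n) <= lnorm p a * lnorm q b.
Proof.
intros Hpq Ha Hb Hsa Hsb.
destruct p as [|p hp|], q as [|q hq|]; simpl in Hpq; try easy.
- subst q.
  destruct (lnorm_Lebesgue_1 hq b Hb Hsb) as [Hex ->].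
  apply Series_mult_bounded; trivial.
  intros n; split; [apply Ha|].
  apply Sup_seq_ge_real, summable_zero_bounded, Hsa.
- set (A := lnorm _ a); set (B := lnorm _ b).
  assert (HA : 0 <= A) by now apply lnorm_ge0.
  assert (HB : 0 <= B) by now apply lnorm_ge0.
  assert (Hp0 : 0 < / p) by (apply Rinv_0_lt_compat; lra).
  assert (Hq0 : 0 < / q) by (apply Rinv_0_lt_compat; lra).
  (* Young's inequality is applied to [a n / s] and [b n / t] and multiplied by [s * t]. The weights
     [al] and [be] are the resulting coefficients of [rpow (a n) p] and [rpow (b n) q]; after
     summation the bound is [s * t * (/ p + / q)]. *)
  assert (Hmain : forall s t, A < s -> B < t ->
    ex_series (fun n => a n * b n) /\ Series (fun n => a n * b n) <= s * t).
  { intros s t Hs Ht.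
    set (al := s * t * / p * / rpow s p).
    set (be := s * t * / q * / rpow t q).
    assert (Hs0 : 0 < rpow s p) by (apply rpow_gt0; lra).
    assert (Ht0 : 0 < rpow t q) by (apply rpow_gt0; lra).
    assert (Hst : 0 <= s * t) by (apply Rmult_le_pos; lra).
    assert (Hal : 0 <= al).
    { apply Rmult_le_pos; [|now apply Rlt_le, Rinv_0_lt_compat].
      apply Rmult_le_pos; lra. }
    assert (Hbe : 0 <= be).
    { apply Rmult_le_pos; [|now apply Rlt_le, Rinv_0_lt_compat].
      apply Rmult_le_pos; lra. }
    pose proof (ex_series_scal_l al _ Hsa) as E1.
    pose proof (ex_series_scal_l be _ Hsb) as E2.
    assert (Hle : forall n, 0 <= a n * b n <=
              al * rpow (a n) p + be * rpow (b n) q).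
    { intros n; split; [now apply Rmult_le_pos|].
      assert (Has : 0 <= a n / s) by (apply Rdiv_le_0_compat; [apply Ha | lra]).
      assert (Hbt : 0 <= b n / t) by (apply Rdiv_le_0_compat; [apply Hb | lra]).
      replace (rpow (a n) p) with (rpow s p * rpow (a n / s) p)
        by (rewrite <- rpow_mult by lra; f_equal; field; lra).
      replace (rpow (b n) q) with (rpow t q * rpow (b n / t) q)
        by (rewrite <- rpow_mult by lra; f_equal; field; lra).
      replace (a n * b n) with (s * t * (a n / s * (b n / t))) by (field; lra).
      pose proof (young_inequality _ _ p q Has Hbt hp hq Hpq) as HY.
      eapply Rle_trans; [apply Rmult_le_compat_l; [exact Hst | exact HY]|].
      right; unfold al, be; field; lra. }
    pose proof (ex_series_plus _ _ E1 E2) as E.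
    split; [exact (ex_series_dominated _ _ Hle E)|].
    eapply Rle_trans; [exact (Series_le _ _ Hle E)|].
    rewrite Series_plus by assumption.
    rewrite !Series_scal_l.
    rewrite (Lebesgue_Series p hp a Hsa), (Lebesgue_Series q hq b Hsb).
    fold A B.
    assert (LA : rpow A p <= rpow s p) by (apply rpow_le; lra).
    assert (LB : rpow B q <= rpow t q) by (apply rpow_le; lra).
    eapply Rle_trans; [apply Rplus_le_compat;
      apply Rmult_le_compat_l; [exact Hal | exact LA | exact Hbe | exact LB]|].
    right; unfold al, be.
    transitivity (s * t * (/ p + / q)); [field; lra | rewrite Hpq; ring]. }
  split; [apply (Hmain (A + 1) (B + 1)); lra|].
  apply Rle_mult_limit; trivial; intros; now apply Hmain.
- assert (Hp : p = 1) by (rewrite <- (Rinv_inv p), <- Rinv_1; f_equal; lra).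
  subst p.
  destruct (lnorm_Lebesgue_1 hp a Ha Hsa) as [Hex ->].
  assert (Hc : forall n, b n * a n = a n * b n) by (intros; ring).
  destruct (Series_mult_bounded b a (lnorm Infinity b)) as [H1 H2]; trivial.
  + intros n; split; [apply Hb | now apply Sup_seq_ge_real].
  + apply (ex_series_ext _ _ Hc) in H1; split; [exact H1|].
    rewrite <- (Series_ext _ _ Hc); lra.
Qed.

(* The extremal test sequences are: the indicator of [0, N] for q = 1, the
   indicator of a point for q = infinity, and b^(q-1) on [0, N] otherwise. *)
Lemma lnorm_le_of_pairing (p q : exponent) (b : nat -> R) (M : R) :
  dual_exponents p q -> 0 <= M -> (forall n, 0 <= b n) ->
  (forall N a, (forall n, 0 <= a n) -> (forall n, (N < n)%nat -> a n = 0) ->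
    sum_n (fun n => a n * b n) N <= M * lnorm p a) ->
  summable q b /\ lnorm q b <= M.
Proof.
intros Hpq HM Hb H.
assert (Htrunc : forall N c,
  sum_n (fun n => (if Nat.leb n N then c n else 0) * b n) N =
  sum_n (fun n => c n * b n) N).
{ intros N c; apply sum_n_ext_loc; intros n Hn.
  now apply Nat.leb_le in Hn; rewrite Hn. }
destruct p as [|p hp|], q as [|q hq|]; simpl in Hpq; try easy.
- subst q.
  assert (Hbd : forall N, sum_n b N <= M).
  { intros N.
    assert (Hle : forall n, (if Nat.leb n N then 1 else 0) <= 1).
    { intros n; destruct (Nat.leb n N); lra. }
    replace (sum_n b N) with
      (sum_n (fun n => (if Nat.leb n N then 1 else 0) * b n) N).
    2: { rewrite Htrunc; apply sum_n_ext; intros; apply Rmult_1_l. }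
    eapply Rle_trans; [apply H|].
    - intros n; destruct (Nat.leb n N); lra.
    - intros n Hn; apply Nat.leb_gt in Hn; now rewrite Hn.
    - rewrite <- (Rmult_1_r M) at 2; apply Rmult_le_compat_l; [exact HM|].
      now apply Sup_seq_le_real. }
  destruct (Series_le_bound b M Hb Hbd) as [Hex Hle].
  apply Lebesgue_dominated with b; trivial.
  + intros n; rewrite rpow_1_r by trivial; lra.
  + now rewrite rpow_1_r.
- assert (Hp0 : 0 < / p) by (apply Rinv_0_lt_compat; lra).
  assert (Hq0 : 0 < / q) by (apply Rinv_0_lt_compat; lra).
  assert (Hbd : forall N, sum_n (fun n => rpow (b n) q) N <= rpow M q).
  { intros N; set (S := sum_n _ N).
    (* For [a = b^(q-1)] on [[0, N]] both [a n * b n] and [rpow (a n) p] equal [rpow (b n) q], so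
       the hypothesis involves only [S]. Dividing by [rpow S (/ p)] then leaves
       [rpow S (/ q) <= M]. *)
    assert (HS : S <= M * rpow S (/ p)).
    { specialize (H N (fun n => if Nat.leb n N then rpow (b n) (q - 1) else 0)).
      cbv beta in H.
      rewrite Htrunc in H.
      rewrite (lnorm_Lebesgue_finite p hp _ N) in H.
      2: { intros n Hn; apply Nat.leb_gt in Hn; now rewrite Hn. }
      replace (sum_n (fun n => rpow (b n) (q - 1) * b n) N) with S in H.
      2: { apply sum_n_ext; intros n.
           rewrite <- (rpow_1_r (b n)) at 3 by trivial.
           rewrite <- rpow_plus; f_equal; ring. }
      replace (sum_n _ N) with S in H.
      2: { apply sum_n_ext_loc; intros n Hn.
           apply Nat.leb_le in Hn; rewrite Hn, rpow_rpow; f_equal.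
           (* This is conjugacy solved for [p]; [q = 1] is impossible because [/ p] is positive. *)
           replace p with (q * / (q - 1)).
           2: { rewrite <- (Rinv_inv p); replace (/ p) with (1 - / q) by lra.
                field; split; [lra|]; intros E; replace q with 1 in * by lra.
                lra. }
           field; intros E; replace q with 1 in * by lra; lra. }
      apply H.
      - intros n; destruct (Nat.leb n N); [apply rpow_ge0 | lra].
      - intros n Hn; apply Nat.leb_gt in Hn; now rewrite Hn. }
    destruct (Rlt_dec 0 S) as [HS0|HS0].
    2: { pose proof (rpow_ge0 M q); lra. }
    assert (HSq : rpow S (/ q) <= M).
    { apply Rmult_le_reg_r with (rpow S (/ p)); [now apply rpow_gt0|].
      rewrite <- rpow_plus, (Rplus_comm (/ q)), Hpq, rpow_1_r; lra. }
    apply (rpow_le _ _ q) in HSq; [|lra].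
    rewrite rpow_rpow, Rinv_l, rpow_1_r in HSq by lra; exact HSq. }
  destruct (Series_le_bound _ _ (fun n => rpow_ge0 (b n) q) Hbd) as [Hex Hle].
  apply Lebesgue_dominated with (fun n => rpow (b n) q); trivial.
  intros; lra.
- apply Sup_seq_le_real; intros n.
  set (d := fun m => if Nat.eqb m n then 1 else 0).
  assert (Hd : forall m, 0 <= d m).
  { intros m; unfold d; destruct (Nat.eqb m n); lra. }
  assert (Hd0 : forall m, (n < m)%nat -> d m = 0).
  { intros m Hm; unfold d; destruct (Nat.eqb_spec m n); [lia | reflexivity]. }
  assert (Hsum : forall c, sum_n (fun m => d m * c m) n = c n).
  { intros c; destruct n as [|n]; [rewrite sum_O; unfold d; simpl; ring|].
    rewrite sum_n_S_R.
    rewrite (sum_n_ext_loc _ (fun _ => 0)), sum_n_const.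
    - unfold d; rewrite Nat.eqb_refl, Rmult_1_l, Rmult_0_r; apply Rplus_0_l.
    - intros m Hm; unfold d.
      destruct (Nat.eqb_spec m (S n)); [lia | apply Rmult_0_l]. }
  specialize (H n d Hd Hd0); rewrite Hsum in H.
  rewrite (lnorm_Lebesgue_finite p hp d n Hd0) in H.
  rewrite (sum_n_ext _ (fun m => d m * 1)), (Hsum (fun _ => 1)), rpow_1_l in H.
  + lra.
  + intros m; unfold d; destruct (Nat.eqb m n);
      [rewrite rpow_1_l | rewrite rpow_0]; symmetry; apply Rmult_1_r.
Qed.

(** Infinity is excluded because the tails of a nonzero constant sequence keep their supremum. For a
    finite exponent, the p-th powers of the tail sum to the remainder of a convergent series. *)
Lemma lnorm_tail (e : exponent) (a : nat -> R) (eps : R) :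
  e <> Infinity -> (forall n, 0 <= a n) -> summable e a -> 0 < eps ->
  exists N0, forall N, (N0 <= N)%nat ->
    lnorm e (fun n => if Nat.leb n N then 0 else a n) <= eps.
Proof.
intros He Ha H Heps; destruct e as [|p hp|]; [| |easy].
- destruct (proj2 (is_lim_seq_spec a 0) H (mkposreal eps Heps)) as [N0 HN0].
  exists N0; intros N HN; apply Sup_seq_le_real; intros n.
  destruct (Nat.leb_spec n N); [lra|].
  specialize (HN0 n ltac:(lia)); simpl in HN0.
  rewrite Rminus_0_r, Rabs_pos_eq in HN0 by apply Ha; lra.
- simpl in H; set (b := fun n => rpow (a n) p) in *.
  pose proof (rpow_gt0 eps p Heps) as Hp.
  (* The remainder is made smaller than [rpow eps p], so that its p-th root is at most [eps]. *)
  destruct (proj2 (is_lim_seq_spec (sum_n b) (Series b)) (Series_correct _ H)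
    (mkposreal _ Hp)) as [N0 HN0]; simpl in HN0.
  exists N0; intros N HN; specialize (HN0 N HN).
  set (h := fun n => if Nat.leb n N then b n else 0).
  assert (Hh : is_series h (sum_n b N)).
  { replace (sum_n b N) with (sum_n h N).
    - apply (is_series_finite (V := R_NormedModule)); intros n Hn; unfold h.
      apply Nat.leb_gt in Hn; now rewrite Hn.
    - apply sum_n_ext_loc; intros n Hn; unfold h.
      apply Nat.leb_le in Hn; now rewrite Hn. }
  pose proof (is_series_minus _ _ _ _ (Series_correct _ H) Hh) as Ht.
  apply Lebesgue_dominated with (fun n => plus (b n) (opp (h n))).
  + lra.
  + intros n; change (plus (b n) (opp (h n))) with (b n - h n); unfold h, b.
    destruct (Nat.leb n N); [rewrite rpow_0|]; lra.
  + exact (ex_intro _ _ Ht).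
  + eapply Rle_trans; [right; exact (is_series_unique _ _ Ht)|].
    change (plus (Series b) (opp (sum_n b N))) with (Series b - sum_n b N).
    apply Rabs_def2 in HN0; lra.
Qed.

(** * Series of scalars, and the reals inside the scalar field *)

Lemma ex_series_abs (k : scalar_field) (a : nat -> k) :
  ex_series (fun n => abs (a n)) ->
  ex_series (V := AbsRing_NormedModule k) a.
Proof.
destruct k; intros H.
- exact (ex_series_le (V := R_CompleteNormedModule) a _ (fun n => Rle_refl _) H).
- destruct (ex_series_le (V := C_CompleteNormedModule) a _
    (fun n => Rle_refl _) H) as [l Hl].
  (* Coquelicot gives [C] the product uniform structure of [R * R], whereas
     [AbsRing_NormedModule] uses the balls of the modulus. *)
  exists l; intros P HP; apply Hl, locally_C, HP.
Qed.

Lemma abs_series_le {K : AbsRing} (a : nat -> K) (b : nat -> R) (l : K) :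
  (forall n, abs (a n) <= b n) -> ex_series b ->
  is_series (V := AbsRing_NormedModule K) a l -> abs l <= Series b.
Proof.
intros Hab Hb Hl.
assert (Hlim : is_lim_seq (fun N => abs (sum_n a N)) (abs l)).
{ exact (filterlim_comp _ _ _ _ _ _ _ _ Hl
    (filterlim_norm (V := AbsRing_NormedModule K) l)). }
refine (is_lim_seq_le _ _ (abs l) (Series b) _ Hlim (Series_correct _ Hb)).
intros N; eapply Rle_trans;
  [exact (norm_sum_n_m (V := AbsRing_NormedModule K) a 0 N)|].
apply sum_n_le; intros n _; apply Hab.
Qed.

Definition of_real (k : scalar_field) (t : R) : k :=
  match k with Real_field => t | Complex_field => RtoC t end.

Lemma of_real_plus (k : scalar_field) (s t : R) :
  of_real k (s + t) = plus (of_real k s) (of_real k t).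
Proof. destruct k; [reflexivity | apply RtoC_plus]. Qed.

Lemma of_real_mult (k : scalar_field) (s t : R) :
  of_real k (s * t) = mult (of_real k s) (of_real k t).
Proof. destruct k; [reflexivity | apply RtoC_mult]. Qed.

Lemma abs_of_real (k : scalar_field) (t : R) : abs (of_real k t) = Rabs t.
Proof. destruct k; [reflexivity | apply Cmod_R]. Qed.

Lemma of_real_sum (k : scalar_field) (r : nat -> R) (N : nat) :
  of_real k (sum_n r N) = sum_n (fun n => of_real k (r n)) N.
Proof.
induction N as [|N IH]; [now rewrite !sum_O|].
now rewrite sum_n_S_R, sum_Sn, of_real_plus, IH.
Qed.

(** [u] rotates [z] onto the nonnegative real axis. In the complex case it is the conjugate of [z]
    divided by the modulus, and 0 at [z = 0], hence a bound on [abs u] instead of an equality. *)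
Lemma scalar_sign (k : scalar_field) (z : k) :
  exists u : k, abs u <= 1 /\ mult u z = of_real k (abs z).
Proof.
destruct k.
- destruct (Rle_dec 0 z) as [Hz|Hz].
  + exists 1; split; [change (Rabs 1 <= 1); rewrite Rabs_R1; lra|].
    change (1 * z = Rabs z); rewrite Rabs_pos_eq by trivial; ring.
  + exists (-1); split; [change (Rabs (-1) <= 1); rewrite Rabs_left; lra|].
    change (-1 * z = Rabs z); rewrite Rabs_left by lra; ring.
- destruct (Ceq_dec z 0) as [->|Hz].
  + exists (RtoC 0); change (Cmod (RtoC 0) <= 1 /\ (0 * 0 = RtoC (Cmod 0))%C).
    rewrite Cmod_0; split; [lra | ring].
  + exists (Cconj z / RtoC (Cmod z))%C.
    change (Cmod (Cconj z / RtoC (Cmod z)) <= 1 /\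
      (Cconj z / RtoC (Cmod z) * z = RtoC (Cmod z))%C).
    pose proof (proj1 (Cmod_gt_0 z) Hz) as Hm.
    assert (Hm' : RtoC (Cmod z) <> 0%C).
    { intros E; apply RtoC_inj in E; lra. }
    split.
    * rewrite Cmod_div, Cmod_conj, Cmod_R, Rabs_pos_eq by (trivial; lra).
      right; field; lra.
    * replace (Cconj z / RtoC (Cmod z) * z)%C
        with (z * Cconj z / RtoC (Cmod z))%C by (field; exact Hm').
      rewrite <- Cmod2_conj, RtoC_pow; field; exact Hm'.
Qed.

(** * Evaluation estimates for the dual norm *)

Section DualNorm.

Context {k : scalar_field} {X : NormedModule k}.

(** The dual norm only sees the unit ball, so [x] is divided by some [t > norm x]; the strict
    inequality also covers [x = 0]. *)
Lemma dual_apply_le (f : dual X) (x : X) : abs (f x) <= norm f * norm x.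
Proof.
rewrite Rmult_comm; apply Rle_mult_limit; try apply norm_ge_0.
intros t s Ht Hs.
pose proof (norm_ge_0 x) as Hx.
destruct (scalars_real_mult k t) as (c & d & Hcd & Hc & Hd); [lra|].
assert (Hdx : norm (scal d x) <= 1).
{ eapply Rle_trans; [apply norm_scal|]; rewrite Hd.
  apply Rmult_le_reg_l with t; [lra|]; field_simplify; lra. }
replace (dual_fun f x) with (mult c (dual_fun f (scal d x))).
2: { rewrite (linear_scal _ (dual_is_linear X f)).
     change (mult c (mult d (dual_fun f x)) = dual_fun f x).
     now rewrite mult_assoc, Hcd, mult_one_l. }
eapply Rle_trans; [apply abs_mult|]; rewrite Hc.
apply Rmult_le_compat_l; [lra|].
apply Rle_trans with (norm f); [exact (dual_norm_ub X f _ Hdx) | lra].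
Qed.

(** The supremum defining the norm need not be attained, hence [eps]. The value is made real so that
    the values at different coordinates can be added without cancellation of phases. *)
Lemma dual_almost_norming (f : dual X) (a eps : R) :
  0 <= a -> 0 < eps ->
  exists (y : X) (r : R),
    norm y <= a /\ f y = of_real k r /\ a * (norm f - eps) <= r.
Proof.
intros Ha Heps.
assert (Hx : exists x : X, norm x <= 1 /\ norm f - eps <= abs (f x)).
{ apply NNPP; intros Hn.
  assert (Hle : norm f <= norm f - eps); [|lra].
  apply (dual_norm_le X f); intros x Hx.
  apply Rnot_lt_le; intros Hlt; apply Hn; exists x; split; [exact Hx | lra]. }
destruct Hx as (x & Hx & Hfx).
destruct (scalar_sign k (f x)) as (u & Hu & Huf).
exists (scal (of_real k a) (scal u x)), (a * abs (f x)); repeat split.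
- eapply Rle_trans; [apply norm_scal|].
  rewrite abs_of_real, Rabs_pos_eq by trivial.
  rewrite <- (Rmult_1_r a) at 2; apply Rmult_le_compat_l; [exact Ha|].
  eapply Rle_trans; [apply norm_scal|].
  pose proof (abs_ge_0 u); pose proof (norm_ge_0 x); nra.
- rewrite !(linear_scal _ (dual_is_linear X f)), of_real_mult, <- Huf.
  reflexivity.
- apply Rmult_le_compat_l; trivial.
Qed.

End DualNorm.

(** * Uniqueness of sums and series with a single nonzero term *)

Lemma minus_plus_cancel {G : AbelianGroup} (a b : G) : minus a (plus a b) = opp b.
Proof.
unfold minus; rewrite opp_plus, plus_assoc.
exact (eq_trans (f_equal (fun c => plus c (opp b)) (plus_opp_r a))
  (plus_zero_l (opp b))).
Qed.

Lemma is_series_eq {K : AbsRing} {V : NormedModule K} (a : nat -> V) (l l' : V) :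
  is_series a l -> is_series a l' -> l = l'.
Proof. apply (filterlim_locally_unique (sum_n a)). Qed.

Lemma is_series_single {K : AbsRing} {V : NormedModule K} (a : nat -> V) (n : nat) :
  (forall m, m <> n -> a m = zero) -> is_series a (a n).
Proof.
intros Ha; replace (a n) with (sum_n a n).
- apply is_series_finite; intros m Hm; apply Ha; lia.
- destruct n as [|n]; [apply sum_O|].
  rewrite sum_Sn, (sum_n_ext_loc a (fun _ => zero)).
  + unfold sum_n; rewrite sum_n_m_const_zero; apply plus_zero_l.
  + intros m Hm; apply Ha; lia.
Qed.

(** * Coordinate embeddings, truncations and the components of a functional *)

Section Embeddings.

Context {k : scalar_field} (p : exponent) (X : nat -> NormedModule k).

(** [X n] and [X m] are different types, so [y] has to be transported along a proof of [n = m]. *)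
Definition single_seq (n : nat) (y : X n) (m : nat) : X m :=
  match Nat.eq_dec n m with
  | left e => eq_rect n (fun i => NormedModule.sort k (X i)) y m e
  | right _ => zero
  end.

(** Equality of natural numbers is decidable, so transport along any proof of [n = n] is the
    identity. *)
Lemma single_seq_same (n : nat) (y : X n) : single_seq n y n = y.
Proof.
unfold single_seq; destruct (Nat.eq_dec n n) as [e|]; [|easy].
symmetry; apply (eq_rect_eq_dec Nat.eq_dec (fun i => NormedModule.sort k (X i))).
Qed.

Lemma single_seq_other (n m : nat) (y : X n) : m <> n -> single_seq n y m = zero.
Proof.
intros H; unfold single_seq; destruct (Nat.eq_dec n m); [now subst | easy].
Qed.

(** Comparison with a multiple of an indicator lets [lnorm_scal] give summability and the norm bound
    for all exponents at once. *)
Lemma single_seq_norm_le (n : nat) (y : X n) (m : nat) :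
  0 <= norm (single_seq n y m) <= norm y * (if Nat.eqb m n then 1 else 0).
Proof.
split; [apply norm_ge_0|].
destruct (Nat.eqb_spec m n) as [->|H].
- rewrite single_seq_same; lra.
- rewrite single_seq_other, norm_zero by trivial; lra.
Qed.

Lemma indicator_summable (n : nat) :
  summable p (fun m => if Nat.eqb m n then 1 else 0).
Proof.
apply summable_finite with n; intros m Hm.
destruct (Nat.eqb_spec m n); [lia | reflexivity].
Qed.

Lemma indicator_ge0 (n m : nat) : 0 <= (if Nat.eqb m n then 1 else 0).
Proof. destruct (Nat.eqb m n); lra. Qed.

Definition single_lnorm (n : nat) (y : X n) :=
  lnorm_scal p (norm y) _ _ (norm_ge_0 y) (indicator_ge0 n)
    (single_seq_norm_le n y) (indicator_summable n).

Definition single (n : nat) (y : X n) : direct_sum p X :=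
  DirectSum (single_seq n y) (proj1 (single_lnorm n y)).

(** A crude constant is enough: it serves only to make the components bounded, and their sharp norms
    are estimated in [component_norms]. Adding 1 to [D] makes it positive. *)
Lemma single_norm_le (n : nat) :
  exists C, 0 < C /\ forall y : X n, norm (single n y) <= C * norm y.
Proof.
set (D := lnorm p (fun m => if Nat.eqb m n then 1 else 0)).
exists (D + 1); split.
- enough (0 <= D) by lra.
  apply lnorm_ge0; [apply indicator_ge0 | apply indicator_summable].
- intros y; pose proof (proj2 (single_lnorm n y)) as H; fold D in H.
  pose proof (norm_ge_0 y).
  apply Rle_trans with (norm y * D); [exact H | nra].
Qed.

Lemma single_plus (n : nat) (y z : X n) :
  single n (plus y z) = plus (single n y) (single n z).
Proof.
apply direct_sum_eq; intros m.
change (single_seq n (plus y z) m = plus (single_seq n y m) (single_seq n z m)).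
destruct (Nat.eq_dec m n) as [->|H].
- now rewrite !single_seq_same.
- rewrite !single_seq_other by trivial; symmetry; apply plus_zero_l.
Qed.

Lemma single_scal (n : nat) (c : k) (y : X n) :
  single n (scal c y) = scal c (single n y).
Proof.
apply direct_sum_eq; intros m.
change (single_seq n (scal c y) m = scal c (single_seq n y m)).
destruct (Nat.eq_dec m n) as [->|H].
- now rewrite !single_seq_same.
- rewrite !single_seq_other by trivial; symmetry; exact (scal_zero_r (V := X m) c).
Qed.

Lemma component_is_linear (g : dual (direct_sum p X)) (n : nat) :
  is_linear (V := AbsRing_NormedModule k) (fun y : X n => g (single n y)).
Proof.
pose proof (dual_is_linear _ g) as Hg.
split.
- intros y z; rewrite single_plus; apply (linear_plus _ Hg).
- intros c y; rewrite single_scal; apply (linear_scal _ Hg).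
- destruct (single_norm_le n) as (C & HC & HCn).
  pose proof (norm_ge_0 g) as Hg0.
  exists ((norm g + 1) * C); split; [apply Rmult_lt_0_compat; lra|].
  intros y; eapply Rle_trans; [exact (dual_apply_le g _)|].
  rewrite Rmult_assoc; apply Rmult_le_compat; try apply norm_ge_0; [lra|].
  apply HCn.
Qed.

Definition component (g : dual (direct_sum p X)) (n : nat) : dual (X n) :=
  Dual _ (component_is_linear g n).

(** The index [N] is included, to match the range of [sum_n _ N]. *)
Definition head_seq (N : nat) (y : forall n, X n) (n : nat) : X n :=
  if Nat.leb n N then y n else zero.

Lemma head_summable (N : nat) (y : forall n, X n) :
  summable p (fun n => norm (head_seq N y n)).
Proof.
apply summable_finite with N; intros n Hn; unfold head_seq.
apply Nat.leb_gt in Hn; rewrite Hn; apply norm_zero.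
Qed.

Definition head (N : nat) (y : forall n, X n) : direct_sum p X :=
  DirectSum (head_seq N y) (head_summable N y).

Lemma head_0 (y : forall n, X n) : head 0 y = single 0 (y 0%nat).
Proof.
apply direct_sum_eq; intros m; change (head_seq 0 y m = single_seq 0 (y 0%nat) m).
destruct m as [|m]; [now rewrite single_seq_same|].
now rewrite single_seq_other.
Qed.

Lemma head_S (N : nat) (y : forall n, X n) :
  head (S N) y = plus (head N y) (single (S N) (y (S N))).
Proof.
apply direct_sum_eq; intros m.
change (head_seq (S N) y m =
  plus (head_seq N y m) (single_seq (S N) (y (S N)) m)).
unfold head_seq; destruct (Nat.eq_dec m (S N)) as [->|H].
- rewrite single_seq_same, Nat.leb_refl.
  replace (Nat.leb (S N) N) with false by (symmetry; apply Nat.leb_gt; lia).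
  symmetry; apply plus_zero_l.
- rewrite single_seq_other, plus_zero_r by trivial.
  destruct (Nat.leb_spec m (S N)), (Nat.leb_spec m N); trivial; lia.
Qed.

Lemma dual_head (g : dual (direct_sum p X)) (N : nat) (y : forall n, X n) :
  g (head N y) = sum_n (fun n => component g n (y n)) N.
Proof.
induction N as [|N IH].
- now rewrite sum_O, head_0.
- rewrite sum_Sn, <- IH, head_S; apply (linear_plus _ (dual_is_linear _ g)).
Qed.

Definition tail_seq (N : nat) (y : forall n, X n) (n : nat) : X n :=
  if Nat.leb n N then zero else y n.

Lemma tail_summable (N : nat) (x : direct_sum p X) :
  summable p (fun n => norm (tail_seq N x n)).
Proof.
refine (proj1 (lnorm_scal p 1 (fun n => norm (x n)) _ Rle_0_1 _ _
  (direct_sum_summable _ _ x))).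
- intros n; apply norm_ge_0.
- intros n; split; [apply norm_ge_0|]; unfold tail_seq.
  pose proof (norm_ge_0 (x n)).
  destruct (Nat.leb n N); rewrite ?norm_zero; lra.
Qed.

Definition tail (N : nat) (x : direct_sum p X) : direct_sum p X :=
  DirectSum (tail_seq N x) (tail_summable N x).

Lemma head_plus_tail (N : nat) (x : direct_sum p X) :
  plus (head N x) (tail N x) = x.
Proof.
apply direct_sum_eq; intros n.
change (plus (head_seq N x n) (tail_seq N x n) = x n).
unfold head_seq, tail_seq.
destruct (Nat.leb n N); [apply plus_zero_r | apply plus_zero_l].
Qed.

Lemma tail_norm_small (x : direct_sum p X) (eps : R) :
  p <> Infinity -> 0 < eps ->
  exists N0, forall N, (N0 <= N)%nat -> norm (tail N x) <= eps.
Proof.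
intros Hp Heps.
destruct (lnorm_tail p (fun n => norm (x n)) eps Hp) as [N0 H]; trivial.
- intros n; apply norm_ge_0.
- apply direct_sum_summable.
- exists N0; intros N HN; eapply Rle_trans; [|exact (H N HN)].
  right; change (norm (tail N x)) with (lnorm p (fun n => norm (tail_seq N x n))).
  f_equal; apply functional_extensionality; intros n; unfold tail_seq.
  destruct (Nat.leb n N); [apply norm_zero | reflexivity].
Qed.

(** The partial sum up to [N] is [g (head N x)], so its distance to [g x] is [abs (g (tail N x))],
    at most [norm g * norm (tail N x)]. *)
Lemma component_series (g : dual (direct_sum p X)) (x : direct_sum p X) :
  p <> Infinity ->
  is_series (V := AbsRing_NormedModule k) (fun n => component g n (x n)) (g x).
Proof.
intros Hp; apply filterlim_locally; intros [eps Heps].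
pose proof (norm_ge_0 g) as Hg0.
(* The added 1 avoids division by zero and makes the final inequality strict. *)
destruct (tail_norm_small x (eps / (norm g + 1)) Hp) as [N0 HN0].
{ apply Rdiv_lt_0_compat; lra. }
exists N0; intros N HN; specialize (HN0 N HN).
apply norm_compat1; simpl pos.
assert (Hdiff : minus (sum_n (fun n => dual_fun (component g n) (x n)) N)
  (dual_fun g x) = opp (dual_fun g (tail N x))).
{ rewrite <- (dual_head g N x).
  replace (dual_fun g x)
    with (plus (dual_fun g (head N x)) (dual_fun g (tail N x)))
    by exact (eq_trans (eq_sym (linear_plus _ (dual_is_linear _ g) _ _))
         (f_equal (dual_fun g) (head_plus_tail N x))).
  exact (minus_plus_cancel (G := scalars k) _ _). }
apply Rle_lt_trans with (abs (dual_fun g (tail N x))).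
{ right; exact (eq_trans (f_equal abs Hdiff)
    (norm_opp (V := AbsRing_NormedModule k) _)). }
eapply Rle_lt_trans; [exact (dual_apply_le g _)|].
apply Rle_lt_trans with (norm g * (eps / (norm g + 1))).
- apply Rmult_le_compat_l; trivial.
- apply Rmult_lt_reg_r with (norm g + 1); [lra|]; field_simplify; nra.
Qed.

Lemma component_norms (q : exponent) (g : dual (direct_sum p X)) :
  dual_exponents p q ->
  summable q (fun n => norm (component g n)) /\
  lnorm q (fun n => norm (component g n)) <= norm g.
Proof.
intros Hpq; apply (lnorm_le_of_pairing p q); trivial.
- apply norm_ge_0.
- intros n; apply norm_ge_0.
- intros N a Ha HaN.
  apply le_epsilon; intros e He.
  set (S := sum_n a N).
  assert (HS : 0 <= S).
  { apply Rle_trans with (sum_n (fun _ => 0) N).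
    - rewrite sum_n_const; lra.
    - now apply sum_n_le. }
  (* Coordinate [n] loses [a n * eps] against the exact norm; the total loss [eps * S] stays below
     [e]. *)
  set (eps := e / (S + 1)).
  assert (Heps : 0 < eps) by (apply Rdiv_lt_0_compat; lra).
  assert (HepsS : eps * S <= e).
  { apply Rmult_le_reg_r with (S + 1); [lra|].
    unfold eps; field_simplify; nra. }
  pose proof (fun n => constructive_indefinite_description _
    (dual_almost_norming (component g n) (a n) eps (Ha n) Heps)) as Hy.
  set (y := fun n => proj1_sig (Hy n)).
  pose proof (fun n => constructive_indefinite_description _
    (proj2_sig (Hy n))) as Hr.
  set (r := fun n => proj1_sig (Hr n)).
  assert (Hyr : forall n, norm (y n) <= a n /\
    component g n (y n) = of_real k (r n) /\
    a n * (norm (component g n) - eps) <= r n).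
  { intros n; exact (proj2_sig (Hr n)). }
  clearbody y r.
  (* All values [component g n (y n)] are real, so [g (head N y)] is the image of the real sum of
     the [r n], which is therefore at most [norm g * norm (head N y)]. *)
  assert (Hgy : abs (g (head N y)) = Rabs (sum_n r N)).
  { rewrite dual_head, <- (abs_of_real k), of_real_sum; f_equal.
    apply sum_n_ext; intros n; apply Hyr. }
  assert (Hhead : norm (head N y) <= lnorm p a).
  { rewrite <- (Rmult_1_l (lnorm p a)).
    refine (proj2 (lnorm_scal p 1 a (fun n => norm (head_seq N y n))
      Rle_0_1 Ha _ _)); [|now apply summable_finite with N].
    intros n; split; [apply norm_ge_0|]; unfold head_seq.
    rewrite Rmult_1_l.
    destruct (Nat.leb n N); [apply Hyr | rewrite norm_zero; apply Ha]. }
  assert (Hsum : sum_n (fun n => a n * (norm (component g n) - eps)) N =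
    sum_n (fun n => a n * norm (component g n)) N - eps * S)
    by apply sum_n_mult_minus.
  assert (Hr' : sum_n (fun n => a n * (norm (component g n) - eps)) N
    <= sum_n r N).
  { apply sum_n_le; intros n _; apply Hyr. }
  pose proof (dual_apply_le g (head N y)) as Hg; rewrite Hgy in Hg.
  pose proof (Rle_abs (sum_n r N)).
  pose proof (Rmult_le_compat_l _ _ _ (norm_ge_0 g) Hhead).
  change (sum_n (fun n => a n * norm (component g n)) N
    <= norm g * lnorm p a + e).
  lra.
Qed.

End Embeddings.

(** * The functional attached to a sequence of functionals, and the isomorphism *)

Section Pairing.

Context {k : scalar_field} {p q : exponent} {X : nat -> NormedModule k}.
Context (Hpq : dual_exponents p q).
Context (f : direct_sum q (fun n => dual (X n))).

(** Hoelder's inequality gives absolute convergence, and the scalars are complete. The bound is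
    proved together with existence so that the chosen sum carries both. *)
Lemma pairing_exists (x : direct_sum p X) :
  exists l : k, is_series (V := AbsRing_NormedModule k) (fun n => f n (x n)) l /\
    abs l <= norm f * norm x.
Proof.
destruct (holder_inequality p q (fun n => norm (x n)) (fun n => norm (f n)) Hpq)
  as [Hex Hle]; try (intros n; apply norm_ge_0).
- apply direct_sum_summable.
- apply direct_sum_summable.
- assert (Hb : forall n, abs (f n (x n)) <= norm (x n) * norm (f n)).
  { intros n; rewrite Rmult_comm; apply dual_apply_le. }
  destruct (ex_series_abs k (fun n => f n (x n))) as [l Hl].
  { refine (ex_series_dominated _ _ _ Hex).
    intros n; split; [apply abs_ge_0 | apply Hb]. }
  exists l; split; [exact Hl|].
  rewrite Rmult_comm; eapply Rle_trans; [|exact Hle].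
  exact (abs_series_le _ _ l Hb Hex Hl).
Qed.

(** The sum is picked by choice from an existence statement; uniqueness of limits ([is_series_eq])
    makes it linear in [x]. *)
Definition pairing (x : direct_sum p X) : k :=
  proj1_sig (constructive_indefinite_description _ (pairing_exists x)).

Lemma pairing_series (x : direct_sum p X) :
  is_series (V := AbsRing_NormedModule k) (fun n => f n (x n)) (pairing x).
Proof.
unfold pairing; destruct (constructive_indefinite_description _ _); apply a.
Qed.

Lemma pairing_le (x : direct_sum p X) : abs (pairing x) <= norm f * norm x.
Proof.
unfold pairing; destruct (constructive_indefinite_description _ _); apply a.
Qed.

Lemma pairing_is_linear : is_linear (V := AbsRing_NormedModule k) pairing.
Proof.
split.
- intros x y; apply (is_series_eq _ _ _ (pairing_series _)).
  refine (is_series_ext _ _ _ _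
    (is_series_plus _ _ _ _ (pairing_series x) (pairing_series y))).
  intros n; symmetry; apply (linear_plus _ (dual_is_linear _ (f n))).
- intros c x; apply (is_series_eq _ _ _ (pairing_series _)).
  refine (is_series_ext _ _ _ _ (is_series_scal c _ _ (pairing_series x))).
  intros n; symmetry; apply (linear_scal _ (dual_is_linear _ (f n))).
- exists (norm f + 1); pose proof (norm_ge_0 f); split; [lra|].
  intros x; eapply Rle_trans; [exact (pairing_le x)|].
  apply Rmult_le_compat_r; [apply norm_ge_0 | lra].
Qed.

Definition pairing_dual : dual (direct_sum p X) := Dual _ pairing_is_linear.

Lemma pairing_dual_norm_le : norm pairing_dual <= norm f.
Proof.
apply (dual_norm_le _ pairing_dual); intros x Hx.
eapply Rle_trans; [exact (pairing_le x)|].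
rewrite <- (Rmult_1_r (norm f)) at 2.
apply Rmult_le_compat_l; [apply norm_ge_0 | exact Hx].
Qed.

(** On a vector supported at [n] the series has one nonzero term. Taking components is thus a left
    inverse of the pairing, which yields both the lower norm bound and injectivity. *)
Lemma component_pairing (n : nat) : component p X pairing_dual n = f n.
Proof.
apply dual_eq; intros y.
apply (is_series_eq _ _ _ (pairing_series (single p X n y))).
replace (dual_fun (f n) y) with (dual_fun (f n) (single_seq X n y n))
  by now rewrite single_seq_same.
apply (is_series_single (V := AbsRing_NormedModule k)
  (fun m => dual_fun (f m) (single_seq X n y m))).
intros m Hm; rewrite single_seq_other by trivial.
apply (linear_zero _ (dual_is_linear _ (f m))).
Qed.

Lemma pairing_dual_norm : norm pairing_dual = norm f.
Proof.
apply Rle_antisym; [apply pairing_dual_norm_le|].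
eapply Rle_trans; [|exact (proj2 (component_norms p X q pairing_dual Hpq))].
right; change (norm f) with (lnorm q (fun n => norm (f n))).
f_equal; apply functional_extensionality; intros n.
now rewrite component_pairing.
Qed.

End Pairing.

Theorem theorem8 (k : scalar_field) (X : nat -> NormedModule k)
    (HX : forall n : nat, nontrivial (X n)) (p q : exponent)
    (Hpq : dual_exponents p q) :
  exists T : direct_sum q (fun n => dual (X n)) -> dual (direct_sum p X),
    isometric_isomorphism T /\
    forall (f : direct_sum q (fun n => dual (X n))) (x : direct_sum p X),
      is_series (V := AbsRing_NormedModule k) (fun n => f n (x n)) (T f x).
Proof.
exists (pairing_dual Hpq); split; [split|].
- intros f g; apply dual_eq; intros x.
  apply (is_series_eq _ _ _ (pairing_series Hpq _ x)).
  exact (is_series_plus _ _ _ _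
    (pairing_series Hpq f x) (pairing_series Hpq g x)).
- intros c f; apply dual_eq; intros x.
  apply (is_series_eq _ _ _ (pairing_series Hpq _ x)).
  exact (is_series_scal c _ _ (pairing_series Hpq f x)).
- apply pairing_dual_norm.
- intros g; destruct (component_norms p X q g Hpq) as [Hs _].
  (* The preimage of [g] is the sequence of its components: its pairing with [x] and [g x] are sums
     of the same series, since [p] is not infinity. Any other preimage has these same components. *)
  exists (DirectSum (X := fun n => dual (X n)) (component p X g) Hs); split.
  + apply dual_eq; intros x.
    apply (is_series_eq _ _ _ (pairing_series Hpq _ x)).
    apply component_series; destruct p; easy.
  + intros f <-; apply direct_sum_eq; intros n; apply component_pairing.
- apply pairing_series.
Qed.
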